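(* Let $H:\mathbb{R}^N\to\mathbb{R}$ be a differentiable function, let $G:\mathbb{R}^N\to\mathbb{R}^{N\times N}$ be a (possibly state-dependent) matrix, and let $u(t)\in\mathbb{R}^N$ be any differentiable solution of $$\frac{\mathrm{d}u}{\mathrm{d}t}=G(u)\,\nabla H(u).$$ (i) If $G(v)\le O$ for every $v\in\mathbb{R}^N$, then the system has the energy dissipation law: $\frac{\mathrm{d}}{\mathrm{d}t}H(u(t))\le 0$ for all $t$. (ii) If $G(v)$ is skew-symmetric for every $v\in\mathbb{R}^N$, then the system has the energy conservation law: $\frac{\mathrm{d}}{\mathrm{d}t}H(u(t))=0$ for all $t$.
   Context: $H$ is called the energy function and $\nabla H(u)$ is its gradient with respect to the state $u$. For a real square matrix $G$ (not assumed symmetric), $G\le O$ means that $G$ is negative semi-definite in the sense that $x^\top G x\le 0$ for every vector $x$. $G$ is skew-symmetric if $G^\top=-G$. *)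

(* Defs.v *)
From mathcomp Require Import all_boot all_order all_algebra.
From mathcomp Require Import all_classical all_reals all_analysis.
Import Order.TTheory GRing.Theory Num.Theory.
Import numFieldNormedType.Exports.

Set Implicit Arguments.
Unset Strict Implicit.
Unset Printing Implicit Defensive.

Local Open Scope ring_scope.
Local Open Scope classical_set_scope.

(* Column vectors carry the library's max norm; since R^N is
   finite-dimensional, differentiability and derivatives are the same as for
   the Euclidean norm. *)
Definition gradient (R : realType) (N : nat) (H : 'cV[R]_N -> R)
    (v : 'cV[R]_N) : 'cV[R]_N :=
  \col_i 'D_(delta_mx i 0) H v.

(* No symmetry of A is required. *)
Definition neg_semidef (R : realType) (N : nat) (A : 'M[R]_N) : Prop :=
  forall x : 'cV[R]_N, (x^T *m A *m x) 0 0 <= 0.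

Definition skew_symmetric (R : realType) (N : nat) (A : 'M[R]_N) : Prop :=
  A^T = - A.

(* J is the time interval, `]-oo, +oo[ for a solution defined on all of R.
   Derivatives are two-sided; a solution on an interval with an endpoint, with
   a one-sided derivative there, is covered by extending it affinely beyond the
   endpoint. *)
Definition is_solution (R : realType) (N : nat) (H : 'cV[R]_N -> R)
    (G : 'cV[R]_N -> 'M[R]_N) (J : interval R) (u : R -> 'cV[R]_N) : Prop :=
  forall t, t \in J ->
    derivable u t 1 /\ u^`() t = G (u t) *m gradient H (u t).

(* Main.v *)
Require Import Defs.
From mathcomp Require Import all_boot all_order all_algebra.
From mathcomp Require Import all_classical all_reals all_analysis.
Import Order.TTheory GRing.Theory Num.Theory.
Import numFieldNormedType.Exports.

Local Open Scope ring_scope.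
Local Open Scope classical_set_scope.

(** By the chain rule ([is_derive_comp_gradient]), the rate of change of energy along a solution is
    $\nabla H(u)^\top u' = \nabla H(u)^\top G(u) \nabla H(u)$, the quadratic form of [G (u t)] at
    the gradient. Its sign is the hypothesis in (i); in (ii) it vanishes by
    [skew_symmetric_form0]. *)

Lemma diff_gradient (R : realType) (N : nat) (H : 'cV[R]_N -> R)
    (v w : 'cV[R]_N) :
  differentiable H v -> 'd H v w = ((gradient H v)^T *m w) 0 0.
Proof.
move=> dH; rewrite [in LHS](matrix_sum_delta w) linear_sum mxE.
apply: eq_bigr => i _.
(* A column vector has a single column, so the inner sum over columns collapses; differentiability
   equates the partial derivative with the differential at the basis vector. *)
by rewrite big_ord1 linearZ /= !mxE deriveE // mulrC.
Qed.

Lemma is_derive_comp_gradient (R : realType) (N : nat) (H : 'cV[R]_N -> R)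
    (u : R -> 'cV[R]_N) (t : R) :
  differentiable H (u t) -> derivable u t 1 ->
  derivable (H \o u) t 1 /\
  (H \o u)^`() t = ((gradient H (u t))^T *m derive1 u t) 0 0.
Proof.
move=> dH /derivable1_diffP du.
have dHu : differentiable (H \o u) t by exact: differentiable_comp.
split; first exact/derivable1_diffP.
(* Both derivatives in [t] become differentials applied to 1, so the chain rule for differentials
   applies. *)
by rewrite !derive1E !deriveE // diff_comp //= diff_gradient.
Qed.

(** A 1 x 1 matrix has the same entry as its transpose, while skewness makes that transpose the
    opposite: the value equals its own negative. *)
Lemma skew_symmetric_form0 (R : realType) (N : nat) (A : 'M[R]_N)
    (x : 'cV[R]_N) :
  skew_symmetric A -> (x^T *m A *m x) 0 0 = 0.
Proof.
move=> skA.
have /matrixP/(_ 0 0) : (x^T *m A *m x)^T = - (x^T *m A *m x).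
  by rewrite !trmx_mul trmxK skA mulNmx mulmxN mulmxA.
by rewrite [LHS]mxE [RHS]mxE => /eqP; rewrite -addr_eq0 -mulr2n mulrn_eq0 => /eqP.
Qed.

Theorem theorem1 (R : realType) (N : nat) (H : 'cV[R]_N -> R)
    (G : 'cV[R]_N -> 'M[R]_N) (J : interval R) (u : R -> 'cV[R]_N)
    (H_diff : forall v : 'cV[R]_N, differentiable H v)
    (u_sol : is_solution H G J u) :
  ((forall v : 'cV[R]_N, neg_semidef (G v)) ->
   forall t : R, t \in J ->
     derivable (H \o u) t 1 /\ (H \o u)^`() t <= 0) /\
  ((forall v : 'cV[R]_N, skew_symmetric (G v)) ->
   forall t : R, t \in J ->
     derivable (H \o u) t 1 /\ (H \o u)^`() t = 0).
Proof.
(* This identity holds for any [G]; sign or skewness enters only when the form is evaluated at the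
   gradient. *)
have energy_rate t : t \in J -> derivable (H \o u) t 1 /\
    (H \o u)^`() t = ((gradient H (u t))^T *m G (u t) *m gradient H (u t)) 0 0.
  move=> /u_sol [du du_eq].
  have [dHu ->] := is_derive_comp_gradient _ _ _ _ _ (H_diff (u t)) du.
  by rewrite du_eq mulmxA.
split=> [G_le0 | G_skew] t /energy_rate [dHu ->]; split=> //.
- exact: G_le0.
- exact: skew_symmetric_form0.
Qed.
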